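(* Let $(D,\varphi)$ be a rank $3$ filtered $\varphi$-module over $K$ with $E$-coefficients in the normal form described in the context (basis $\underline e=(e_0,e_1,e_2)$, $\mathrm{Mat}_{\underline e}(\varphi)=\mathrm{diag}(\vec a,\vec b,\vec c)$ with pairwise distinct norms, filtration at each $i$ of type $\mathcal F_0,\mathcal F_1,\mathcal F_2$ or $\mathcal F_3$), and let $I_1,I_2,I_3$ be the index sets defined in the context. Then $(D,\varphi)$ is weakly admissible if and only if all of the following hold: (A) $$v_p(\mathrm{Nm}_\varphi(\vec a))+v_p(\mathrm{Nm}_\varphi(\vec b))+v_p(\mathrm{Nm}_\varphi(\vec c))=\sum_{i\in I_1}(k_1(i)+k_2(i))+\sum_{i\in I_2}2k(i)+\sum_{i\in I_3}k(i);$$ (B) $$v_p(\mathrm{Nm}_\varphi(\vec a))\ge \sum_{\substack{i\in I_1\\ x_2(i)=0,\ x_1(i)\ne0}}k_1(i)+\sum_{\substack{i\in I_1\\ x_1(i)=x_2(i)=0}}k_2(i)+\sum_{\substack{i\in I_2\\ x_2(i)=0}}k(i)+\sum_{\substack{i\in I_3\\ x_1(i)=x_2''(i)=0}}k(i);$$ (C) $$v_p(\mathrm{Nm}_\varphi(\vec b))\ge\sum_{\substack{i\in I_1\\ x_2'(i)=0}}k_1(i)+\sum_{\substack{i\in I_2\\ x_2'(i)=0}}k(i);$$ (D) $$v_p(\mathrm{Nm}_\varphi(\vec c))\ge 0;$$ (E) $$v_p(\mathrm{Nm}_\varphi(\vec a))+v_p(\mathrm{Nm}_\varphi(\vec b))\ge\sum_{\substack{i\in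 I_1\\ x_2''(i)\ne0}}k_1(i)+\sum_{\substack{i\in I_1\\ x_2''(i)=0,\ x_2'(i)=1}}k_2(i)+\sum_{\substack{i\in I_1\\ x_2(i)=x_2'(i)=0}}(k_1(i)+k_2(i))$$ $$\qquad+\sum_{\substack{i\in I_2\\ x_2'(i)=1\text{ or }(x_2'(i)=0\text{ and }x_2(i)\ne0)}}k(i)+\sum_{\substack{i\in I_2\\ x_2(i)=x_2'(i)=0}}2k(i)+\sum_{\substack{i\in I_3\\ x_2''(i)=0}}k(i);$$ (F) $$v_p(\mathrm{Nm}_\varphi(\vec a))+v_p(\mathrm{Nm}_\varphi(\vec c))\ge\sum_{\substack{i\in I_1\\ x_1(i)\ne0}}k_1(i)+\sum_{\substack{i\in I_1\\ x_1(i)=0}}k_2(i)+\sum_{i\in I_2}k(i)+\sum_{\substack{i\in I_3\\ x_1(i)=0}}k(i);$$ (G) $$v_p(\mathrm{Nm}_\varphi(\vec b))+v_p(\mathrm{Nm}_\varphi(\vec c))\ge\sum_{i\in I_1}k_1(i)+\sum_{i\in I_2}k(i).$$ Moreover, assuming that $(D,\varphi)$ is weakly admissible, it is irreducible in the category of weakly admissible filtered $\varphi$-modules over $K$ with $E$-coefficients if and only if all inequalities (B)-(G) are strict. Furthermore, assuming that $(D,\varphi)$ is weakly admissible: (a) the submodule $D_0=E^{|\tau|}e_0$ is weakly admissible if and only if (B) is an equality; (b) the submodule $D_1=E^{|\tau|}e_1$ is weakly admissible if and only if (C) is an equality; (c) the submodule $D_2=E^{|\tau|}e_2$ is weakly admissible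 if and only if (D) is an equality; (d) the submodule $D_{01}=E^{|\tau|}e_0\oplus E^{|\tau|}e_1$ is weakly admissible if and only if (E) is an equality; (e) the submodule $D_{02}=E^{|\tau|}e_0\oplus E^{|\tau|}e_2$ is weakly admissible if and only if (F) is an equality; (f) the submodule $D_{12}=E^{|\tau|}e_1\oplus E^{|\tau|}e_2$ is weakly admissible if and only if (G) is an equality.
   Context: Let $p$ be a fixed odd prime, $K=\mathbb{Q}_{p^f}$ the unramified extension of $\mathbb{Q}_p$ of degree $f$, and $E$ a finite, large enough extension of $K$; $v_p$ is the $p$-adic valuation with $v_p(p)=1$. Let $\sigma_K$ be the absolute Frobenius of $K$, fix an embedding $\tau_0:K\hookrightarrow E$ and put $\tau_i=\tau_0\circ\sigma_K^i$ for $i=0,\dots,f-1$. Put $E^{|\tau|}=\prod_{i=0}^{f-1}E$ (coordinates indexed by $\tau_0,\dots,\tau_{f-1}$), identified with $K\otimes_{\mathbb{Q}_p}E$ via $x\otimes y\mapsto(\tau_i(x)y)_i$. Frobenius on $K$ induces the ring automorphism $\varphi(x_0,x_1,\dots,x_{f-1})=(x_1,\dots,x_{f-1},x_0)$ of $E^{|\tau|}$. Let $e_{\tau_i}\in E^{|\tau|}$ be the idempotent with $1$ in the $\tau_i$-coordinate and $0$ elsewhere. Elements of $E$ act through the diagonal $E\to E^{|\tau|}$. For $\vec x\in E^{|\tau|}$ with coordinates $x(i)$, $\mathrm{Nm}_\varphi(\vec x)=\prod_{i=0}^{f-1}x(i)\in E$. A filtered $\varphi$-module over $K$ with $E$-coefficients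 is a finite free $E^{|\tau|}$-module $D$ with a bijective additive map $\varphi:D\to D$ semilinear with respect to the automorphism $\varphi$ of $E^{|\tau|}$, and a decreasing, exhaustive, separated filtration $\mathrm{Fil}^jD$ ($j\in\mathbb{Z}$) by $E^{|\tau|}$-submodules. Submodules stable under $\varphi$ carry the induced filtration. Weakly admissible has the usual meaning: $t_N(D)=t_H(D)$ and $t_H(D^* )\le t_N(D^* )$ for all $\varphi$-stable subobjects $D^*$, where $t_H$ and $t_N$ are the Hodge and Newton numbers. $\mathrm{Mat}_{\underline e}(\varphi)$ is the matrix with $\varphi(\underline e)=\underline e\,\mathrm{Mat}_{\underline e}(\varphi)$. Normal form. $(D,\varphi)$ has rank $3$, with an ordered basis $\underline e=(e_0,e_1,e_2)$ over $E^{|\tau|}$ such that $\mathrm{Mat}_{\underline e}(\varphi)=\mathrm{diag}(\vec a,\vec b,\vec c)$, where $\vec a,\vec b,\vec c\in(E^\times)^f$ and $\mathrm{Nm}_\varphi(\vec a),\mathrm{Nm}_\varphi(\vec b),\mathrm{Nm}_\varphi(\vec c)$ are pairwise distinct. The filtration is $\mathrm{Fil}^jD=\bigoplus_{i=0}^{f-1}\mathrm{Fil}^j(e_{\tau_i}D)$; at each $i$ there are integers $0=k_0(i)\le k_1(i)\le k_2(i)$ (the labeled Hodge-Tate weights at $\tau_i$), and: ($\mathcal F_0$) if $0<k_1(i)<k_2(i)$: $\mathrm{Fil}^j(e_{\tau_i}D)$ equals $e_{\tau_i}D$ for $j\le0$; $e_{\tau_i}E^{|\tau|}(e_0+x_2(i)e_2)\oplus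 e_{\tau_i}E^{|\tau|}(e_1+x_2'(i)e_2)$ for $1\le j\le k_1(i)$; $e_{\tau_i}E^{|\tau|}(e_0+x_1(i)e_1+x_2''(i)e_2)$ for $1+k_1(i)\le j\le k_2(i)$; and $0$ for $j\ge 1+k_2(i)$; with $x_1(i)\in E$, $x_2(i),x_2'(i)\in\{0,1\}$, $x_2''(i)=x_2(i)+x_1(i)x_2'(i)$. If $0<k_1(i)=k_2(i)$ or $0=k_1(i)<k_2(i)$, let $k(i)$ denote the nonzero weight; the filtration is one of: ($\mathcal F_1$) $\mathrm{Fil}^j(e_{\tau_i}D)$ equals $e_{\tau_i}D$ for $j\le0$; $e_{\tau_i}E^{|\tau|}(e_0+x_2(i)e_2)\oplus e_{\tau_i}E^{|\tau|}(e_1+x_2'(i)e_2)$ for $1\le j\le k(i)$; $0$ for $j\ge1+k(i)$; with $x_2(i),x_2'(i)\in\{0,1\}$; ($\mathcal F_2$) $\mathrm{Fil}^j(e_{\tau_i}D)$ equals $e_{\tau_i}D$ for $j\le0$; $e_{\tau_i}E^{|\tau|}(e_0+x_1(i)e_1+x_2''(i)e_2)$ for $1\le j\le k(i)$; $0$ for $j\ge1+k(i)$; with $x_1(i),x_2''(i)\in\{0,1\}$. ($\mathcal F_3$) if $k_1(i)=k_2(i)=0$: $\mathrm{Fil}^j(e_{\tau_i}D)$ equals $e_{\tau_i}D$ for $j\le0$ and $0$ for $j\ge1$. Index sets (subsets of $\{0,\dots,f-1\}$): $I_1$ is the set of $i$ with $0<k_1(i)<k_2(i)$ (filtration of type $\mathcal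 F_0$); $I_2$ is the set of $i$ with exactly two distinct weights and filtration of type $\mathcal F_1$; $I_3$ is the set of $i$ with exactly two distinct weights and filtration of type $\mathcal F_2$. *)

(* Defs.v *)
From HB Require Import structures.
From mathcomp Require Import all_boot all_order all_algebra all_field.
From mathcomp Require Import boolp classical_sets fsbigop.

Set Implicit Arguments.
Unset Strict Implicit.
Unset Printing Implicit Defensive.

Import Order.TTheory GRing.Theory Num.Theory.
Local Open Scope ring_scope.

(** * p-adic fields *)

(* Valuations are rat-valued and only meaningful on nonzero elements: [v 0] is
   unspecified, and [vge v r x] means "v(x) >= r" with v(0) = +oo. *)
Definition vge (F : fieldType) (v : F -> rat) (r : rat) (x : F) : bool :=
  (x == 0) || (r <= v x).

Record normalized_valuation (p : nat) (F : fieldType) (v : F -> rat) : Prop :=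
  NormalizedValuation {
    nv_char0 : [pchar F] =i pred0;
    nv_mul : forall x y, x != 0 -> y != 0 -> v (x * y) = v x + v y;
    nv_add : forall x y r, vge v r x -> vge v r y -> vge v r (x + y);
    nv_p : v p%:R = 1 }.

(* Q_p, characterized as the completion of Q for the p-adic valuation. *)
Record padic_numbers (p : nat) (F : fieldType) (v : F -> rat) : Prop :=
  PadicNumbers {
    pn_val : normalized_valuation p v;
    pn_dense : forall (x : F) (n : nat),
      exists q : rat, vge v n%:R (x - ratr q);
    pn_complete : forall u : nat -> F,
      (forall n : nat, exists m0, forall m1 m2,
         (m0 <= m1)%N -> (m0 <= m2)%N -> vge v n%:R (u m1 - u m2)) ->
      exists l, forall n : nat, exists m0, forall m,
         (m0 <= m)%N -> vge v n%:R (u m - l) }.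

(* K / Q_p is unramified, with absolute Frobenius [sigma] (the lift of the p-th
   power map); E / Q_p is finite and is an extension of K through [tau0]; [vE]
   is the valuation of E with vE(p) = 1, and that of K is [vE \o tau0]. *)
Record padic_coefficients (p : nat) := PadicCoefficients {
  Qp : fieldType;
  vQp : Qp -> rat;
  QpP : padic_numbers p vQp;
  K : fieldExtType Qp;
  E : fieldExtType Qp;
  vE : E -> rat;
  vE_val : normalized_valuation p vE;
  vE_ext : forall x : Qp, x != 0 -> vE x%:A = vQp x;
  tau0 : 'AHom(K, E);
  K_unramified : forall x : K, x != 0 ->
    exists2 y : Qp, y != 0 & vE (tau0 x) = vQp y;
  sigma : 'AEnd(K);
  sigma_frobenius : forall x : K, vge vE 0 (tau0 x) ->
    vge vE 1 (tau0 (sigma x - x ^+ p)) }.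

Definition degf (p : nat) (C : padic_coefficients p) : nat := \dim {:K C}.

Definition tau (p : nat) (C : padic_coefficients p) (i : 'I_(degf C)) :
  K C -> E C := fun x => tau0 C (iter i (sigma C) x).

(** * The ring E^{|tau|} *)

(* Coordinate i is the one of tau_i. *)
Notation Etau f E := {ffun 'I_f -> E}.

(* The identification of K (x) E with E^{|tau|}, on pure tensors. *)
Definition pure_tensor (p : nat) (C : padic_coefficients p)
  (x : K C) (y : E C) : Etau (degf C) (E C) := [ffun i => tau i x * y].

Section Coefficients.
Variables (f : nat) (E : fieldType).

Definition Ediag (y : E) : Etau f E := [ffun=> y].

Definition Eidem (i : 'I_f) : Etau f E := [ffun j => (j == i)%:R].

(* (x_0, ..., x_{f-1}) |-> (x_1, ..., x_{f-1}, x_0) *)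
Definition frobE (x : Etau f E) : Etau f E := [ffun i => x (ordS i)].

Definition Nm (x : Etau f E) : E := \prod_(i < f) x i.

(** * Filtered phi-modules *)

(* An E^{|tau|}-module D is given by its underlying E-vector space together
   with the action [scal] of E^{|tau|}, whose restriction to the diagonal is
   the E-vector space structure.  Since [frobE] fixes the diagonal, a
   semilinear phi is E-linear, hence an element of 'End(D); likewise all
   E^{|tau|}-submodules are E-subspaces. *)
Definition is_basis (D : vectType E) (scal : Etau f E -> 'End(D))
    (n : nat) (e : 'I_n -> D) : Prop :=
  forall d : D, exists! x : {ffun 'I_n -> Etau f E},
    d = \sum_(s < n) scal (x s) (e s).

Record filtered_phi_module := FilteredPhiModule {
  fpm_sort :> vectType E;
  scal : Etau f E -> 'End(fpm_sort);
  scalD : forall x y, scal (x + y) = scal x + scal y;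
  scalM : forall x y, scal (x * y) = (scal x \o scal y)%VF;
  scal_diag : forall y : E, scal (Ediag y) = y *: \1%VF;
  fpm_free : exists n (e : 'I_n -> fpm_sort), is_basis scal e;
  phi : 'End(fpm_sort);
  phi_bij : bijective phi;
  phi_semilinear : forall x d, phi (scal x d) = scal (frobE x) (phi d);
  Fil : int -> {vspace fpm_sort};
  Fil_submodule : forall j x, (scal x @: Fil j <= Fil j)%VS;
  Fil_decreasing : forall j j' : int, j <= j' -> (Fil j' <= Fil j)%VS;
  Fil_exhaustive : forall d, exists j, d \in Fil j;
  Fil_separated : forall d, (forall j, d \in Fil j) -> d = 0 }.

Section Module.
Variable D : filtered_phi_module.

Definition subobject (U : {vspace D}) : Prop :=
  (forall x, (scal D x @: U <= U)%VS) /\ (phi D @: U <= U)%VS.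

(* Hodge and Newton numbers of a subobject U of D, with the filtration
   U :&: Fil^j D induced from D.  Both are computed over the coefficient field
   E, i.e. t_H(U) = sum_j j dim_E gr^j U and t_N(U) = v_p(det_E(phi | U)).
   The numbers of the filtered phi-module over K obtained by forgetting the
   coefficients, sum_j j dim_K gr^j U and v_p(det_K(phi | U)), are [E : K] times
   these.  The sum below is over all integers, with finite support. *)
Definition dim_gr (U : {vspace D}) (j : int) : nat :=
  (\dim (U :&: Fil D j) - \dim (U :&: Fil D (j + 1)))%N.

Definition tH (U : {vspace D}) : int :=
  \sum_(j \in @classical_sets.setT int) j * (dim_gr U j)%:Z.

Definition phi_mx (U : {vspace D}) : 'M[E]_(\dim U) :=
  \matrix_(i, j) coord (vbasis U) i (phi D (vbasis U)`_j).

Definition tN (v : E -> rat) (U : {vspace D}) : rat := v (\det (phi_mx U)).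

Definition weakly_admissible_sub (v : E -> rat) (U : {vspace D}) : Prop :=
  [/\ subobject U, tN v U = (tH U)%:~R &
      forall V, subobject V -> (V <= U)%VS -> (tH V)%:~R <= tN v V].

Definition weakly_admissible (v : E -> rat) : Prop :=
  weakly_admissible_sub v fullv.

Definition irreducible (v : E -> rat) : Prop :=
  {:D}%VS <> 0%VS /\
  (forall U, weakly_admissible_sub v U -> U = 0%VS \/ U = fullv).

(* The submodule E^{|tau|} d, as the sum of the lines e_{tau_i} E^{|tau|} d. *)
Definition Etau_span (d : D) : {vspace D} :=
  (\sum_(i < f) <[scal D (Eidem i) d]>)%VS.

Lemma mem_Etau_span (d d' : D) :
  d' \in Etau_span d <-> exists x : Etau f E, d' = scal D x d.
Proof.
have scal_sum (I : finType) (y : I -> Etau f E) :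
    scal D (\sum_i y i) = \sum_i scal D (y i).
  apply: (big_morph (scal D) (@scalD D)).
  by apply: (addrI (scal D 0)); rewrite -scalD !addr0.
have scal_comp x i : scal D (Eidem i) (scal D x d) = x i *: scal D (Eidem i) d.
  rewrite -comp_lfunE -scalM.
  have -> : Eidem i * x = Ediag (x i) * Eidem i.
    apply/ffunP=> j; rewrite !ffunE.
    by case: eqP => [->|]; rewrite ?mul1r ?mulr1 ?mul0r ?mulr0.
  by rewrite scalM scal_diag comp_lfunE scale_lfunE id_lfunE.
split=> [/memv_sumP[y y_line ->]|[x ->]].
  have z i : {c : E | y i = c *: scal D (Eidem i) d}.
    by apply: cid; have /vlineP[c ->] := y_line i isT; exists c.
  exists (\sum_i Ediag (sval (z i)) * Eidem i).
  rewrite scal_sum sum_lfunE; apply: eq_bigr => i _.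
  by rewrite scalM scal_diag comp_lfunE scale_lfunE id_lfunE {1}(svalP (z i)).
have -> : x = \sum_i Eidem i * x.
  apply/ffunP=> j; rewrite sum_ffunE (bigD1 j) //= !ffunE eqxx mul1r.
  rewrite big1 ?addr0 // => i; rewrite eq_sym !ffunE => /negPf->.
  by rewrite mul0r.
rewrite scal_sum sum_lfunE; apply: memv_sumr => i _.
by rewrite scalM comp_lfunE scal_comp; apply/memvZ/memv_line.
Qed.

(** * The rank 3 normal form *)

Definition is_matrix_of_phi (n : nat) (e : 'I_n -> D)
    (M : 'M[Etau f E]_n) : Prop :=
  forall t, phi D (e t) = \sum_(s < n) scal D (M s t) (e s).

Definition diag3 (a b c : Etau f E) : 'M[Etau f E]_3 :=
  diag_mx (\row_(s < 3) [:: a; b; c]`_s).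

(* e_{tau_i} U, for a submodule U; Fil^j(e_{tau_i} D) is e_{tau_i} Fil^j D. *)
Definition component (i : 'I_f) (U : {vspace D}) : {vspace D} :=
  (scal D (Eidem i) @: U)%VS.

(* e_{tau_i} E^{|tau|} d, which is the E-line of e_{tau_i} d. *)
Definition line (i : 'I_f) (d : D) : {vspace D} := <[scal D (Eidem i) d]>%VS.

Variables (e : 'I_3 -> D) (k1 k2 : 'I_f -> nat) (x1 x2 x2' x2'' : Etau f E).

Definition type_F0 (i : 'I_f) : Prop :=
  [/\ x2 i = 0 \/ x2 i = 1, x2' i = 0 \/ x2' i = 1,
      x2'' i = x2 i + x1 i * x2' i &
      forall j : int, component i (Fil D j) =
        if j <= 0 then component i fullv
        else if j <= k1 i then
          (line i (e 0 + x2 i *: e 2)%R + line i (e 1 + x2' i *: e 2)%R)%VS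
        else if j <= k2 i then line i (e 0 + x1 i *: e 1 + x2'' i *: e 2)
        else 0%VS].

(* When there are two distinct weights, the nonzero one k(i) is k2 i. *)
Definition type_F1 (i : 'I_f) : Prop :=
  [/\ x2 i = 0 \/ x2 i = 1, x2' i = 0 \/ x2' i = 1 &
      forall j : int, component i (Fil D j) =
        if j <= 0 then component i fullv
        else if j <= k2 i then
          (line i (e 0 + x2 i *: e 2)%R + line i (e 1 + x2' i *: e 2)%R)%VS
        else 0%VS].

Definition type_F2 (i : 'I_f) : Prop :=
  [/\ x1 i = 0 \/ x1 i = 1, x2'' i = 0 \/ x2'' i = 1 &
      forall j : int, component i (Fil D j) =
        if j <= 0 then component i fullv
        else if j <= k2 i then line i (e 0 + x1 i *: e 1 + x2'' i *: e 2)
        else 0%VS].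

Definition type_F3 (i : 'I_f) : Prop :=
  forall j : int, component i (Fil D j) = if j <= 0 then component i fullv else 0%VS.

Definition two_weights (i : 'I_f) : bool :=
  (0 < k1 i)%N && (k1 i == k2 i) || (k1 i == 0)%N && (k1 i < k2 i)%N.

Record normal_form (a b c : Etau f E) : Prop := NormalForm {
  nf_basis : is_basis (scal D) e;
  nf_phi : is_matrix_of_phi e (diag3 a b c);
  nf_units : forall i, [/\ a i != 0, b i != 0 & c i != 0];
  nf_norms : [/\ Nm a != Nm b, Nm a != Nm c & Nm b != Nm c];
  nf_weights : forall i, (k1 i <= k2 i)%N;
  nf_F0 : forall i, (0 < k1 i < k2 i)%N -> type_F0 i;
  nf_F12 : forall i, two_weights i -> type_F1 i \/ type_F2 i;
  nf_F3 : forall i, k1 i = 0%N -> k2 i = 0%N -> type_F3 i }.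

Definition I1 : {set 'I_f} := finset (fun i => (0 < k1 i < k2 i)%N).
Definition I2 : {set 'I_f} :=
  finset (fun i => two_weights i && `[< type_F1 i >]).
Definition I3 : {set 'I_f} :=
  finset (fun i => two_weights i && `[< type_F2 i >]).

End Module.

End Coefficients.

(* Main.v *)
(* As [phi] permutes the components e_{tau_i} D cyclically, [phi^f] is E^{|tau|}-linear
   and acts on [E^{|tau|} e_s] by the scalar Nm(a), Nm(b) or Nm(c).  These being
   distinct, a subobject is a sum of eigencomponents of [phi^f], hence one of the
   eight submodules spanned by a subset [T] of the basis [e].  Its Newton number
   is the sum of the valuations of the norms indexed by [T], and its Hodge number
   is a sum over [i] of the dimensions of the intersections of the coordinate
   subspace of [T] with the plane and the line of the filtration at [i]. *)

Require Import Defs.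
From HB Require Import structures.
From mathcomp Require Import all_boot all_order all_algebra all_field.
From mathcomp Require Import boolp classical_sets fsbigop.
From mathcomp Require Import ring zify.

Set Implicit Arguments.
Unset Strict Implicit.
Unset Printing Implicit Defensive.

Import Order.TTheory GRing.Theory Num.Theory.
Local Open Scope ring_scope.

(** * Finite sums, cyclic shifts and subsets of a 3-element set *)

(** Two features shape the computation. The eigenvalues of [phi^f] over E repeat once for each
    tau_i, so distinctness of the norms separates vectors only inside one component; [phi], which is
    invertible there, then carries the conclusion to the other components. Likewise [phi] is not
    diagonal on the E-basis of vectors e_{tau_i} e_s, so its determinant is reached only through its
    f-th power, hence up to an f-th root of unity, which the rational-valued valuation does not see.

    On the Hodge side, summation by parts replaces the graded dimensions by the dimensions of the
    intersections with Fil^j for j >= 1. These split over i, so each bound of the theorem is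
    compared with a Hodge number one index at a time, a finite check on which of the parameters x
    vanish. *)

Lemma sum_lt_const (N k m : nat) : (k <= N)%N -> (\sum_(j < N) (j < k) * m = m * k)%N.
Proof.
(* With [minn k N] in place of the right-hand [k], the identity holds for every N, and the induction
   can drop [k <= N]. *)
move/minn_idPl => {2}<-; elim: N => [|N IHN]; first by rewrite big_ord0 minn0 muln0.
rewrite big_ord_recr /= IHN; have -> : minn k N.+1 = (minn k N + (N < k))%N by lia.
by rewrite mulnDr (mulnC (N < k)%N).
Qed.

Lemma iter_ordSE f m (j : 'I_f) :
  iter m (@ordS f) j = ((j + m) %% f)%N :> nat.
Proof.
elim: m => [|m IHm]; first by rewrite addn0 modn_small.
by rewrite iterS /= IHm -[in LHS]addn1 modnDml addn1 addnS.
Qed.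

(** The shift is a single f-cycle. Injectivity on f exponents gives a bijection, hence both
    transitivity on the components and the identification of a product along an orbit with a
    norm. *)
Lemma injective_iter_ordS f (j : 'I_f) :
  injective (fun m : 'I_f => iter m (@ordS f) j).
Proof.
move=> m m' /(congr1 val) /=; rewrite !iter_ordSE => /eqP.
by rewrite eqn_modDl !modn_small // => /eqP /val_inj.
Qed.

Lemma iter_ordS_surj f (i j : 'I_f) : exists m, iter m (@ordS f) j = i.
Proof.
have [h _ hK] := injF_bij (@injective_iter_ordS f j).
by exists (h i); rewrite hK.
Qed.

Lemma prod_iter_ordS f (R : comNzRingType) (F : 'I_f -> R) (j : 'I_f) :
  \prod_(m < f) F (iter m (@ordS f) j) = \prod_i F i.
Proof. by rewrite [RHS](reindex_inj (@injective_iter_ordS f j)). Qed.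

Lemma ord3P (P : 'I_3 -> Prop) : P 0 -> P 1 -> P 2 -> forall s, P s.
Proof.
by move=> P0 P1 P2 [[|[|[|//]]] lts];
  [move: P0 | move: P1 | move: P2]; congr P; apply: val_inj.
Qed.

Lemma set3_ind (P : {set 'I_3} -> Prop) :
  P finset.set0 -> P [set 0]%SET -> P [set 1]%SET -> P [set 2]%SET ->
  P [set 0; 1]%SET -> P [set 0; 2]%SET -> P [set 1; 2]%SET -> P finset.setT ->
  forall T, P T.
Proof.
move=> P0 P1 P2 P3 P4 P5 P6 P7 T.
have TE (T' : {set 'I_3}) : 0 \in T = (0 \in T') -> 1 \in T = (1 \in T') ->
    2 \in T = (2 \in T') -> P T' -> P T.
  by move=> T0 T1 T2; suff -> : T = T' by []; apply/setP; apply: ord3P.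
case T0: (0 \in T); case T1: (1 \in T); case T2: (2 \in T).
- by apply: (TE _ _ _ _ P7); rewrite ?T0 ?T1 ?T2 !inE.
- by apply: (TE _ _ _ _ P4); rewrite ?T0 ?T1 ?T2 !inE.
- by apply: (TE _ _ _ _ P5); rewrite ?T0 ?T1 ?T2 !inE.
- by apply: (TE _ _ _ _ P1); rewrite ?T0 ?T1 ?T2 !inE.
- by apply: (TE _ _ _ _ P6); rewrite ?T0 ?T1 ?T2 !inE.
- by apply: (TE _ _ _ _ P2); rewrite ?T0 ?T1 ?T2 !inE.
- by apply: (TE _ _ _ _ P3); rewrite ?T0 ?T1 ?T2 !inE.
by apply: (TE _ _ _ _ P0); rewrite ?T0 ?T1 ?T2 !inE.
Qed.

Lemma card_set3 (T : {set 'I_3}) :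
  #|T| = ((0%R \in T) + (1%R \in T) + (2%R \in T))%N.
Proof.
by move: T; apply: set3_ind;
  rewrite ?cards0 ?cards1 ?cards2 ?cardsT ?card_ord !inE.
Qed.

Lemma sum_in_cond (I : finType) (A : {set I}) (P : pred I) (F : I -> nat) :
  (\sum_(i in A | P i) F i = \sum_i (i \in A) * (P i * F i))%N.
Proof.
by rewrite big_mkcond; apply: eq_bigr => i _; case: (i \in A); case: (P i);
  rewrite /= ?mul1n ?mul0n.
Qed.

Lemma sum_in (I : finType) (A : {set I}) (F : I -> nat) :
  (\sum_(i in A) F i = \sum_i (i \in A) * F i)%N.
Proof.
by rewrite big_mkcond; apply: eq_bigr => i _; case: (i \in A); rewrite ?mul1n ?mul0n.
Qed.

(** * Linear algebra and valuations *)

(* Applying the product of the [g - lam t], t != s, isolates [w s]. *)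
Lemma eigenvector_components (F : fieldType) (V : vectType F) (I : finType)
    (g : 'End(V)) (lam : I -> F) (w : I -> V) (U : {vspace V}) :
  injective lam -> (forall s, g (w s) = lam s *: w s) ->
  (g @: U <= U)%VS -> \sum_s w s \in U -> forall s, w s \in U.
Proof.
move=> lam_inj gw gU wU s.
have isolate (r : seq I) : \sum_u (\prod_(t <- r) (lam u - lam t)) *: w u \in U.
  elim: r => [|t r IHr].
    by rewrite (eq_bigr w) // => u _; rewrite big_nil scale1r.
  have := memvB (subvP gU _ (memv_img g IHr)) (memvZ (lam t) IHr).
  rewrite linear_sum scaler_sumr -sumrB; congr (_ \in U).
  apply: eq_bigr => u _; rewrite big_cons linearZ /= gw !scalerA -scalerBl.
  by rewrite mulrBl [lam u * _]mulrC.
have := isolate [seq t <- index_enum I | t != s].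
pose c := \prod_(t | t != s) (lam s - lam t).
have -> : \sum_u (\prod_(t <- [seq t <- index_enum I | t != s])
    (lam u - lam t)) *: w u = c *: w s.
  rewrite [LHS](bigD1 s) //= big_filter -/c.
  rewrite -[RHS]addr0; congr (_ + _); apply: big1 => u us.
  by rewrite big_filter (bigD1 u) //= subrr mul0r scale0r.
move=> cU.
suff c0 : c != 0 by rewrite -(scale1r (w s)) -(mulVf c0) -scalerA memvZ.
apply/prodf_neq0 => t ts; rewrite subr_eq0.
by apply: contra ts => /eqP /lam_inj ->.
Qed.

(** The image of [U] under a linear form has dimension 0 or 1, so rank-nullity leaves a defect of
    one exactly when the form is nonzero on [U]. *)
Lemma dim_cap_lker (F : fieldType) (V : vectType F) (h : 'Hom(V, F^o))
    (U : {vspace V}) :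
  (\dim (U :&: lker h) + ~~ (U <= lker h)%VS)%N = \dim U.
Proof.
rewrite -[RHS](limg_ker_dim h); congr (_ + _)%N.
rewrite lkerE; have := dimvS (subvf (h @: U)%VS).
rewrite dimvf -dimv_eq0; rewrite /dim /=.
by case: (\dim _) => [|[]].
Qed.

Lemma dim_cap_vline (F : fieldType) (V : vectType F) (U : {vspace V}) (w : V) :
  w != 0 -> \dim (U :&: <[w]>) = (w \in U).
Proof.
move=> w0; case: (boolP (w \in U)) => wU.
  by rewrite (capv_idPr _) ?dim_vline ?w0 // -memvE.
apply/eqP; rewrite dimv_eq0 -subv0; apply/subvP => d.
rewrite memv_cap memv0 => /andP[+ /vlineP[k dE]]; rewrite dE.
have [->|k0] := eqVneq k 0; first by rewrite scale0r.
by move=> kU; have := memvZ k^-1 kU; rewrite scalerA mulVf // scale1r (negPf wU).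
Qed.

Section ValuationSum.
Variables (F : fieldType) (v : F -> rat).
Hypothesis vM : forall x y, x != 0 -> y != 0 -> v (x * y) = v x + v y.

Lemma val1 : v 1 = 0.
Proof. by apply: (addrI (v 1)); rewrite -vM ?oner_neq0 // mulr1 addr0. Qed.

Lemma val_prod (I : finType) (P : pred I) (x : I -> F) :
  (forall i, x i != 0) -> v (\prod_(i | P i) x i) = \sum_(i | P i) v (x i).
Proof.
(* Additivity of [v] is available only on nonzero elements, so the induction carries nonvanishing
   along with the valuation. *)
move=> x0; pose Q y r := (y != 0) /\ v y = r.
suff [] : Q (\prod_(i | P i) x i) (\sum_(i | P i) v (x i)) by [].
apply: (big_rec2 Q); first by split; [exact: oner_neq0 | exact: val1].
move=> i r y _ [y0 yE]; split; first by rewrite mulf_neq0.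
by rewrite vM // yE.
Qed.

Lemma valX x m : x != 0 -> v (x ^+ m) = m%:R * v x.
Proof.
move=> x0; elim: m => [|m IHm]; first by rewrite expr0 val1 mul0r.
by rewrite exprS vM ?expf_neq0 // IHm mulrS mulrDl mul1r.
Qed.

End ValuationSum.

(** * Modules over E^{|tau|} *)

Section EtauModule.
Variables (f : nat) (E : fieldType) (D : filtered_phi_module f E).
Implicit Types (U V : {vspace D}) (d : D).

(** The linear half of [subobject], kept apart because it also applies to the Fil^j, which need not
    be stable under [phi]. *)
Definition submodule U := forall x, (scal D x @: U <= U)%VS.

Lemma scal_idem (x : Etau f E) i d :
  scal D (Eidem E i) (scal D x d) = x i *: scal D (Eidem E i) d.
Proof.
rewrite -comp_lfunE -scalM.
have -> : Eidem E i * x = Ediag f (x i) * Eidem E i.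
  by apply/ffunP=> j; rewrite !ffunE; case: eqP => [->|]; rewrite
    ?mul1r ?mulr1 ?mul0r ?mulr0.
by rewrite scalM scal_diag comp_lfunE scale_lfunE id_lfunE.
Qed.

Lemma scal_sum (I : finType) (x : I -> Etau f E) :
  scal D (\sum_i x i) = \sum_i scal D (x i).
Proof.
apply: (big_morph (scal D) (@scalD _ _ D)).
by apply: (addrI (scal D 0)); rewrite -scalD !addr0.
Qed.

Lemma scal_decomp (x : Etau f E) d :
  scal D x d = \sum_i x i *: scal D (Eidem E i) d.
Proof.
have {1}-> : x = \sum_i Eidem E i * x.
  apply/ffunP=> j; rewrite sum_ffunE (bigD1 j) //= !ffunE eqxx mul1r.
  rewrite big1 ?addr0 // => i; rewrite eq_sym !ffunE => /negPf->.
  by rewrite mul0r.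
rewrite scal_sum sum_lfunE; apply: eq_bigr => i _.
by rewrite scalM comp_lfunE scal_idem.
Qed.

Lemma scal1 d : scal D 1 d = d.
Proof.
have -> : 1 = Ediag f (1 : E) by apply/ffunP => i; rewrite !ffunE.
by rewrite scal_diag scale1r id_lfunE.
Qed.

Lemma scal0 d : scal D 0 d = 0.
Proof. by rewrite scal_decomp big1 // => i _; rewrite ffunE scale0r. Qed.

Lemma idem_sum d : d = \sum_i scal D (Eidem E i) d.
Proof.
rewrite -[LHS]scal1 scal_decomp.
by apply: eq_bigr => i _; rewrite ffunE scale1r.
Qed.

Lemma mem_component U i d : submodule U -> d \in U ->
  scal D (Eidem E i) d \in U.
Proof. by move=> subU dU; apply: (subvP (subU _)); apply: memv_img. Qed.

Lemma component_idem i U d : d \in component i U -> scal D (Eidem E i) d = d.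
Proof. by case/memv_imgP => y _ ->; rewrite scal_idem ffunE eqxx scale1r. Qed.

Lemma component_idem_neq i j U d :
  j != i -> d \in component i U -> scal D (Eidem E j) d = 0.
Proof.
by move=> ji /memv_imgP[y _ ->]; rewrite scal_idem ffunE (negPf ji) scale0r.
Qed.

Lemma component_sub U i : submodule U -> (component i U <= U)%VS.
Proof. by apply. Qed.

(** The idempotent is a projector, so its image is its fixed part. Unlike the image, the fixed part
    visibly commutes with intersections. *)
Lemma memv_component U i d :
  submodule U -> (d \in component i U) =
    (d \in U) && (scal D (Eidem E i) d == d).
Proof.
move=> subU; apply/idP/andP => [dU | [dU /eqP <-]]; last exact: memv_img.
by rewrite (component_idem dU) (subvP (component_sub i subU)).
Qed.

Lemma dim_components U :
  submodule U -> \dim U = (\sum_i \dim (component i U))%N.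
Proof.
move=> subU; have defU : U = (\sum_i component i U)%VS.
  apply/eqP; rewrite eqEsubv; apply/andP; split; last first.
    by apply/subv_sumP => i _; apply: component_sub.
  apply/subvP => d dU; rewrite [d]idem_sum.
  by apply: memv_sumr => i _; apply: memv_img.
rewrite {1}defU; apply/directvP/directv_sum_independent => us us_in us0 i _.
have := congr1 (scal D (Eidem E i)) us0; rewrite linear0 linear_sum.
rewrite (bigD1 i) //= (component_idem (us_in i isT)) big1 ?addr0 // => j ji.
by rewrite (component_idem_neq _ (us_in j isT)) // eq_sym.
Qed.

Lemma submodule_cap U V : submodule U -> submodule V -> submodule (U :&: V).
Proof.
move=> subU subV x; apply: subv_trans (limg_cap _ _ _) _.
by apply: capvS; [apply: subU | apply: subV].
Qed.

Lemma component_cap U V i : submodule U -> submodule V ->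
  component i (U :&: V) = (component i U :&: component i V)%VS.
Proof.
move=> subU subV; apply/vspaceP => d.
rewrite memv_cap !memv_component ?memv_cap //; last exact: submodule_cap.
by case: (_ == d); rewrite ?andbT ?andbF.
Qed.

Lemma dim_capFil U (j : int) : submodule U ->
  \dim (U :&: Fil D j) = (\sum_i \dim (component i U :&: component i (Fil D j)))%N.
Proof.
move=> subU; have subF : submodule (Fil D j) by apply: Fil_submodule.
rewrite dim_components; last exact: submodule_cap.
by apply: eq_bigr => i _; rewrite component_cap.
Qed.

(** The graded pieces vanish for j < 0, where Fil^j and Fil^(j+1) are both D, and for j >= N, where
    both are 0. In between the filtration decreases, so the truncated subtraction in [dim_gr] is
    exact. *)
Lemma tH_sum_dim U (N : nat) : (fullv <= Fil D 0)%VS -> (Fil D N <= 0)%VS ->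
  tH U = (\sum_(j < N) \dim (U :&: Fil D (j%:Z + 1)))%N%:Z.
Proof.
move=> Fil0 FilN.
have FilF j : j <= 0 -> Fil D j = fullv.
  by move=> j0; apply/vspaceP => d; rewrite memvf (subvP (Fil_decreasing D j0))
    // (subvP Fil0) // memvf.
have Fil_out (j : int) : N%:Z <= j -> Fil D j = 0%VS.
  move=> jN; apply/eqP; rewrite -subv0.
  exact: subv_trans (Fil_decreasing D jN) FilN.
pose g (j : nat) := \dim (U :&: Fil D j%:Z).
have gS j : (g j.+1 <= g j)%N.
  by apply/dimvS/capvS/Fil_decreasing; rewrite // lez_nat.
have gN : g N = 0%N by rewrite /g Fil_out // capv0 dimv0.
have -> : tH U = \sum_(j < N) j%:Z * (g j - g j.+1)%N%:Z.
  have iotaN : uniq [seq j%:Z | j <- iota 0 N].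
    by rewrite map_inj_uniq ?iota_uniq // => i j [].
  rewrite /tH (fsbigE [seq j%:Z | j <- iota 0 N]) //; last first.
    move=> [j|j] _ jN; rewrite /dim_gr; last first.
      by rewrite !FilF ?subnn ?mulr0 // NegzE -addn1 PoszD opprD subrK oppr_le0.
    have Nj : (N <= j)%N.
      by rewrite leqNgt; apply: contra jN => jN; rewrite map_f // mem_iota.
    by rewrite !Fil_out ?subnn ?mulr0 // (le_trans (_ : _ <= j%:Z)) ?lerDl.
  rewrite big_map -{1}[N]subn0 -/(index_iota 0 N) big_mkord.
  apply: eq_big => [j|j _]; first by rewrite in_setT.
  by rewrite /g /dim_gr intS addrC.
(* Abel summation *)
have abel M : \sum_(j < M) j%:Z * (g j - g j.+1)%N%:Z + M%:Z * (g M)%:Z =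
    (\sum_(j < M) g j.+1)%N%:Z.
  elim: M => [|M IHM]; first by rewrite !big_ord0 mul0r addr0.
  rewrite !big_ord_recr /= PoszD -IHM -subzn // intS; ring.
have := abel N; rewrite gN mulr0 addr0 => ->.
by congr Posz; apply: eq_bigr => j _; rewrite /g intS addrC.
Qed.

End EtauModule.

(** * Coordinates over E attached to a basis over E^{|tau|}, and coordinate submodules *)

Section Basis.
Variables (f : nat) (E : fieldType) (D : filtered_phi_module f E).
Variables (n : nat) (e : 'I_n -> D).
Hypothesis e_basis : is_basis (scal D) e.
Implicit Types (T : {set 'I_n}) (U V : {vspace D}) (d : D).

Definition idem_vec (si : 'I_n * 'I_f) : D := scal D (Eidem E si.2) (e si.1).

Definition coordsub T : {vspace D} := (\sum_(s in T) Etau_span (e s))%VS.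

Lemma sum_idem_vec (c : 'I_n * 'I_f -> E) :
  \sum_si c si *: idem_vec si = \sum_s scal D [ffun i => c (s, i)] (e s).
Proof.
rewrite (eq_bigr (fun s => \sum_i c (s, i) *: idem_vec (s, i))); last first.
  by move=> s _; rewrite scal_decomp; apply: eq_bigr => i _; rewrite ffunE.
by rewrite pair_bigA /=; apply: eq_bigr => -[].
Qed.

Lemma idem_vec_coordP d :
  exists c : 'I_n * 'I_f -> E, d = \sum_si c si *: idem_vec si.
Proof.
have [x [-> _]] := e_basis d; exists (fun si => x si.1 si.2).
rewrite sum_idem_vec; apply: eq_bigr => s _; congr (scal D _ _).
by apply/ffunP => i; rewrite ffunE.
Qed.

Lemma idem_vec_coord_inj (c c' : 'I_n * 'I_f -> E) :
  \sum_si c si *: idem_vec si = \sum_si c' si *: idem_vec si -> c =1 c'.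
Proof.
rewrite !sum_idem_vec => cc' [s i].
have [x [_ x_uniq]] := e_basis (\sum_s scal D [ffun i => c (s, i)] (e s)).
have xc := x_uniq [ffun s => [ffun i => c (s, i)]].
have xc' := x_uniq [ffun s => [ffun i => c' (s, i)]].
have : [ffun s => [ffun i => c (s, i)]] = [ffun s => [ffun i => c' (s, i)]].
  rewrite -[LHS]xc; first by apply: xc'; rewrite cc';
    apply: eq_bigr => u _; rewrite ffunE.
  by apply: eq_bigr => u _; rewrite ffunE.
by move=> /ffunP /(_ s) /[!ffunE] /ffunP /(_ i); rewrite !ffunE.
Qed.

(** The coefficients are obtained by choice; their uniqueness makes them linear. The codomain [E^o]
    is E as a vector space over itself, so that [linfun] applies. *)
Definition idem_coord (si : 'I_n * 'I_f) (d : D) : E^o :=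
  sval (cid (idem_vec_coordP d)) si.

Lemma idem_coordK d : d = \sum_si idem_coord si d *: idem_vec si.
Proof. by rewrite /idem_coord; case: cid. Qed.

Lemma idem_coordE (c : 'I_n * 'I_f -> E) si :
  idem_coord si (\sum_ti c ti *: idem_vec ti) = c si.
Proof. by move: si; apply: idem_vec_coord_inj; rewrite -idem_coordK. Qed.

Lemma idem_coord_linear si : linear (idem_coord si).
Proof.
move=> k d d'; rewrite {1}[d]idem_coordK {1}[d']idem_coordK scaler_sumr -big_split.
rewrite (eq_bigr (fun ti => (k * idem_coord ti d + idem_coord ti d') *: idem_vec ti)).
  by rewrite idem_coordE.
by move=> ti _; rewrite /= scalerA -scalerDl.
Qed.

HB.instance Definition _ si := GRing.isLinear.Build E D E^o _
  (idem_coord si) (idem_coord_linear si).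

Definition coordf si : 'Hom(D, E^o) := linfun (idem_coord si).

Lemma coordfE si d : coordf si d = idem_coord si d.
Proof. by rewrite lfunE. Qed.

Lemma coordf_idem_vec si ti : coordf si (idem_vec ti) = (si == ti)%:R.
Proof.
rewrite coordfE -(idem_coordE (fun si => (si == ti)%:R)) (bigD1 ti) //= eqxx scale1r.
by rewrite big1 ?addr0 // => ui /negPf ->; rewrite scale0r.
Qed.

Lemma coordfK d : d = \sum_si coordf si d *: idem_vec si.
Proof. by rewrite {1}[d]idem_coordK; apply: eq_bigr => si _; rewrite coordfE. Qed.

Lemma coordf_inj d d' : (forall si, coordf si d = coordf si d') -> d = d'.
Proof.
move=> dd'; rewrite [d]coordfK [d']coordfK.
by apply: eq_bigr => si _; rewrite dd'.
Qed.

Lemma scal_idem_vec (x : Etau f E) s i :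
  scal D x (idem_vec (s, i)) = x i *: idem_vec (s, i).
Proof.
rewrite scal_decomp (bigD1 i) //= scal_idem ffunE eqxx scale1r big1 ?addr0 //.
by move=> j ji; rewrite scal_idem ffunE (negPf ji) scale0r scaler0.
Qed.

Lemma coordf_scal (x : Etau f E) s i d :
  coordf (s, i) (scal D x d) = x i * coordf (s, i) d.
Proof.
rewrite {1}[d]coordfK !linear_sum /= [d in RHS]coordfK linear_sum mulr_sumr.
apply: eq_bigr => -[t j] _; rewrite !linearZ /= scal_idem_vec linearZ /=.
rewrite coordf_idem_vec; case: eqP => [[_ ->]|_]; last by rewrite !scaler0 mulr0.
by rewrite /GRing.scale /= mulrCA.
Qed.

Lemma mem_coordsub T d :
  d \in coordsub T <-> forall s i, s \notin T -> coordf (s, i) d = 0.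
Proof.
split=> [/memv_sumP[ds ds_in ->] s i sT | d0].
  rewrite linear_sum big1 // => t tT; have /memv_sumP[us us_in ->] := ds_in t tT.
  rewrite linear_sum big1 // => j _; have /vlineP[k ->] := us_in j isT.
  rewrite linearZ /= (coordf_idem_vec _ (t, j)) xpair_eqE.
  by case: eqP sT => [->|_ _]; rewrite ?tT // scaler0.
rewrite [d]coordfK; apply: memv_suml => -[s i] _.
case sT: (s \in T); last by rewrite d0 ?sT // scale0r mem0v.
rewrite memvZ // /coordsub (bigD1 s) //=; apply: subvP (addvSl _ _) _ _.
by apply/mem_Etau_span; exists (Eidem E i).
Qed.

Lemma coordsub_full : coordsub finset.setT = fullv.
Proof.
apply/vspaceP => d; rewrite memvf; apply/mem_coordsub => s i.
by rewrite inE.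
Qed.

Lemma coordsub_submodule T : submodule (coordsub T).
Proof.
move=> x; apply/subvP => _ /memv_imgP[d /mem_coordsub d0 ->].
by apply/mem_coordsub => s i sT; rewrite coordf_scal d0 ?mulr0.
Qed.

Lemma mem_coordsub_component T i d :
  d \in component i (coordsub T) <->
  forall s j, ~~ ((s \in T) && (j == i)) -> coordf (s, j) d = 0.
Proof.
rewrite memv_component; last exact: coordsub_submodule.
split=> [/andP[/mem_coordsub d0 /eqP <-] s j | d0].
  rewrite coordf_scal ffunE negb_and => /orP[/d0 -> | /negPf ->].
    by rewrite mulr0.
  by rewrite mul0r.
apply/andP; split; first by apply/mem_coordsub => s j /negPf sT; rewrite d0 ?sT.
apply/eqP/coordf_inj => -[s j]; rewrite coordf_scal ffunE.
by case: eqP => [->|/eqP /negPf ji]; rewrite ?mul1r // mul0r d0 // ji andbF.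
Qed.

Definition idem_tuple (A : {set 'I_n * 'I_f}) : #|A|.-tuple D :=
  [tuple idem_vec (enum_val k) | k < #|A|].

Lemma free_idem_tuple (A : {set 'I_n * 'I_f}) : free (idem_tuple A).
Proof.
apply/freeP => c c0 k.
have := congr1 (coordf (enum_val k)) c0.
rewrite linear0 linear_sum (bigD1 k) //= big1 ?addr0 => [|l lk].
  by rewrite linearZ /= nth_mktuple coordf_idem_vec eqxx /GRing.scale /= mulr1.
rewrite linearZ /= nth_mktuple coordf_idem_vec.
by rewrite (inj_eq enum_val_inj) eq_sym (negPf lk) scaler0.
Qed.

(** Serves twice: with [A] the product of [T] and one index, for the dimension of a component, and
    with [A] the product of [T] and all indices, for the determinant of [phi]. *)
Lemma basis_idem_tuple (A : {set 'I_n * 'I_f}) U :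
  (forall d, d \in U <-> forall si, si \notin A -> coordf si d = 0) ->
  basis_of U (idem_tuple A).
Proof.
move=> memU; pose X := idem_tuple A.
rewrite -/X basisEfree free_idem_tuple; have XU : (<<X>> <= U)%VS.
  apply/span_subvP => _ /mapP[k _ ->]; apply/memU => si siA.
  rewrite coordf_idem_vec; case: eqP siA => // ->.
  by rewrite enum_valP.
rewrite XU; suff UX : (U <= <<X>>)%VS by rewrite (leq_trans (dimvS UX)) ?dim_span.
apply/subvP => d /memU d0; rewrite [d]coordfK; apply: memv_suml => si _.
case siA: (si \in A); last by rewrite d0 ?siA // scale0r mem0v.
rewrite memvZ // memv_span //; apply/mapP.
by exists (enum_rank_in siA si); rewrite ?mem_enum // enum_rankK_in.
Qed.

Lemma dim_coordsub_component T i : \dim (component i (coordsub T)) = #|T|.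
Proof.
have /size_basis : basis_of (component i (coordsub T))
    (idem_tuple (finset.setX T [set i]%SET)).
  apply: basis_idem_tuple => d; apply: iff_trans (mem_coordsub_component _ _ _) _.
  split=> [d0 [s j] | d0 s j]; last by move=> sj; apply: d0; rewrite !inE.
  by rewrite !inE /= => /d0.
by move=> ->; rewrite cardsX cards1 muln1.
Qed.

End Basis.

(** * Diagonal Frobenius *)

Section DiagonalPhi.
Variables (f : nat) (E : fieldType) (D : filtered_phi_module f E).
Variables (n : nat) (e : 'I_n -> D) (A : 'I_n -> Etau f E).
Hypothesis e_basis : is_basis (scal D) e.
Hypothesis phi_e : forall s, phi D (e s) = scal D (A s) (e s).
Hypothesis A_neq0 : forall s i, A s i != 0.
Hypothesis Nm_inj : injective (fun s => Nm (A s)).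
Implicit Types (T : {set 'I_n}) (U V : {vspace D}) (d : D).

Definition iter_phi m : 'End(D) := iter m (fun h => phi D \o h)%VF \1%VF.

Lemma iter_phiS m d : iter_phi m.+1 d = phi D (iter_phi m d).
Proof. by rewrite /iter_phi /= comp_lfunE. Qed.

(** Each application of [phi] shifts the coordinates and multiplies by [A s], which accumulates a
    product along the orbit of j. A general m is needed: m = f gives the norm, other m move between
    components. *)
Lemma iter_phi_scal m x s :
  iter_phi m (scal D x (e s)) =
  scal D [ffun j => x (iter m (@ordS f) j) *
                    \prod_(l < m) A s (iter l (@ordS f) j)] (e s).
Proof.
elim: m => [|m IHm].
  rewrite /iter_phi /= id_lfunE; congr (scal D _ _).
  by apply/ffunP => j; rewrite ffunE big_ord0 mulr1.
rewrite iter_phiS IHm phi_semilinear phi_e -comp_lfunE -scalM.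
congr (scal D _ _); apply/ffunP => j; rewrite !ffunE -iterSr -mulrA.
congr (_ * _); rewrite big_ord_recl mulrC; congr (_ * _).
by apply: eq_bigr => l _; rewrite -iterSr.
Qed.

Lemma iter_phi_Nm x s :
  iter_phi f (scal D x (e s)) = Nm (A s) *: scal D x (e s).
Proof.
rewrite iter_phi_scal; have -> : [ffun j => x (iter f (@ordS f) j) *
    \prod_(l < f) A s (iter l (@ordS f) j)] = Ediag f (Nm (A s)) * x.
  apply/ffunP => j; rewrite !ffunE prod_iter_ordS mulrC; congr (_ * x _).
  apply: val_inj; rewrite /= iter_ordSE modnDr modn_small //.
by rewrite scalM scal_diag comp_lfunE scale_lfunE id_lfunE.
Qed.

Lemma iter_phi_sub U m : (phi D @: U <= U)%VS -> (iter_phi m @: U <= U)%VS.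
Proof.
move=> phiU; elim: m => [|m IHm]; first by rewrite lim1g.
by rewrite /iter_phi /= limg_comp (subv_trans _ phiU) // limgS.
Qed.

Lemma coordsub_subobject T : subobject (coordsub e T).
Proof.
split; first exact: coordsub_submodule.
rewrite limg_sum; apply/subv_sumP => s sT; apply: (sumv_sup s) => // {T sT}.
apply/subvP => _ /memv_imgP[_ /mem_Etau_span[x ->] ->]; apply/mem_Etau_span.
by exists (frobE x * A s); rewrite phi_semilinear phi_e scalM comp_lfunE.
Qed.

(** The vector is first cut down to the component at tau_i. Its summands there are eigenvectors of
    [phi^f] with distinct eigenvalues, so each of them lies in [U]. *)
Lemma subobject_idem_vec U s i d : subobject U -> d \in U ->
  coordf e_basis (s, i) d != 0 -> idem_vec e (s, i) \in U.
Proof.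
move=> [subU phiU] dU ds.
have : \sum_t coordf e_basis (t, i) d *: idem_vec e (t, i) \in U.
  have <- : scal D (Eidem E i) d = \sum_t coordf e_basis (t, i) d *: idem_vec e (t, i).
    apply: (coordf_inj (e_basis := e_basis)) => -[t j].
    rewrite coordf_scal ffunE linear_sum (bigD1 t) //= big1 ?addr0 => [|u ut].
      rewrite linearZ /= coordf_idem_vec xpair_eqE eqxx /=.
      by case: eqP => [->|_]; rewrite ?mul1r ?mul0r /GRing.scale /= ?mulr1 ?mulr0.
    rewrite linearZ /= coordf_idem_vec xpair_eqE eq_sym (negPf ut).
    exact: scaler0.
  exact: mem_component.
move=> dU_i; have compU g gw gU := eigenvector_components (g := g) Nm_inj gw gU dU_i.
pose k : E := coordf e_basis (s, i) d.
suff kU : k *: idem_vec e (s, i) \in U.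
  by have := memvZ k^-1 kU; rewrite scalerA mulVf // scale1r.
apply: (compU (iter_phi f) _ (iter_phi_sub f phiU)) => t.
by rewrite linearZ /= iter_phi_Nm scalerA mulrC -scalerA.
Qed.

Lemma subobject_orbit U s i j : subobject U ->
  idem_vec e (s, i) \in U -> idem_vec e (s, j) \in U.
Proof.
(* As [frobE] reads the coordinate at [ordS i], [phi^m] carries the component at i to the index j
   with [iter m ordS j = i]; so m is counted from j to i. *)
move=> [subU phiU] iU; have [m mij] := iter_ordS_surj i j.
have := mem_component j subU (subvP (iter_phi_sub m phiU) _ (memv_img _ iU)).
rewrite iter_phi_scal scal_idem ffunE mij ffunE eqxx mul1r.
rewrite -[X in _ *: X]/(idem_vec e (s, j)); set c := \prod_(_ < _) _.
suff c0 : c != 0 by move=> cU; have := memvZ c^-1 cU; rewrite scalerA mulVf ?scale1r.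
by apply/prodf_neq0.
Qed.

Lemma subobject_coordsub U : (0 < f)%N ->
  subobject U -> exists T, U = coordsub e T.
Proof.
move=> f_gt0 objU; pose i0 := Ordinal f_gt0.
(* By [subobject_orbit], membership at the single index [i0] decides membership at all indices. *)
exists (finset (fun s => idem_vec e (s, i0) \in U)).
apply/vspaceP => d; apply/idP/idP => [dU | /(mem_coordsub e_basis) d0].
  apply/(mem_coordsub e_basis) => s i; rewrite inE => sU.
  apply: contraNeq sU => /(subobject_idem_vec objU dU).
  exact: subobject_orbit.
rewrite (coordfK e_basis d); apply: memv_suml => -[s i] _.
case sU: (idem_vec e (s, i0) \in U).
  by rewrite memvZ // (subobject_orbit _ objU sU).
by rewrite d0 ?inE ?sU // scale0r mem0v.
Qed.

(* [X] diagonalizes [phi^k] but not [phi]: taking [k]-th powers of the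
   determinant avoids the sign of the permutation underlying [phi]. *)
Lemma det_phi_mx_eigen U m (X : m.-tuple D) (lam : 'I_m -> E) k :
  (phi D @: U <= U)%VS -> basis_of U X ->
  (forall j : 'I_m, iter_phi k X`_j = lam j *: X`_j) ->
  \det (phi_mx U) ^+ k = \prod_j lam j.
Proof.
move=> phiU basX; have dimU := size_basis basX.
(* Identifying m with [\dim U] makes the coordinate matrices [C Y] below square. *)
subst m => Xlam.
pose C (Y : 'I_(\dim U) -> D) := \matrix_(i, j) coord (vbasis U) i (Y j).
have XU (j : 'I_(\dim U)) : X`_j \in U.
  by apply: (basis_mem basX); rewrite mem_nth ?size_tuple.
have phiC (Y : 'I_(\dim U) -> D) : (forall j, Y j \in U) ->
    phi_mx U *m C Y = C (fun j => phi D (Y j)).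
  move=> YU; apply/matrixP => i j; rewrite !mxE.
  rewrite [in RHS](coord_vbasis (YU j)) !linear_sum; apply: eq_bigr => l _.
  by rewrite !mxE !linearZ /= mulrC.
(* Left multiplication by [phi_mx U] applies [phi] to every column of [C Y]. At l = k the columns
   are scaled eigenvectors, and the nonzero determinant of the coordinates of X cancels. *)
have iterC l : \det (phi_mx U) ^+ l * \det (C (fun j => X`_j)) =
    \det (C (fun j => iter_phi l X`_j)).
  elim: l => [|l IHl].
    rewrite expr0 mul1r; congr (\det _); apply/matrixP => i j.
    by rewrite !mxE id_lfunE.
  rewrite exprS -mulrA IHl -det_mulmx phiC.
    by congr (\det _); apply/matrixP => i j; rewrite !mxE iter_phiS.
  by move=> j; apply: subvP (iter_phi_sub l phiU) _ (memv_img _ (XU j)).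
have detX : \det (C (fun j => X`_j)) != 0.
  have : C (fun j => X`_j) *m (\matrix_(i, j) coord X i (vbasis U)`_j) = 1%:M.
    apply/matrixP => i j; rewrite !mxE.
    have vbU : (vbasis U)`_j \in U by rewrite vbasis_mem // mem_nth ?size_tuple.
    rewrite eq_sym -(coord_free j i (basis_free (vbasisP U))).
    rewrite [in RHS](coord_basis basX vbU) linear_sum; apply: eq_bigr => l _.
    by rewrite !mxE linearZ /= mulrC.
  by move/mulmx1_unit => [+ _]; rewrite unitmxE unitfE.
apply: (mulIf detX); rewrite iterC.
have -> : C (fun j => iter_phi k X`_j) = C (fun j => X`_j) *m diag_mx (\row_j lam j).
  apply/matrixP => i j; rewrite mul_mx_diag !mxE Xlam linearZ /= mulrC //.
by rewrite det_mulmx det_diag mulrC; congr (_ * _); apply: eq_bigr => j _; rewrite mxE.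
Qed.

(** Both sides are the determinant of [phi^f], where each norm occurs once for every tau_i. The
    exponents f do not cancel in E; this is done after applying the valuation. *)
Lemma det_phi_mx_coordsub T :
  \det (phi_mx (coordsub e T)) ^+ f = (\prod_(s in T) Nm (A s)) ^+ f.
Proof.
pose J : {set 'I_n * 'I_f} := finset.setX T [set: 'I_f]%SET.
have basJ : basis_of (coordsub e T) (idem_tuple e J).
  apply: (basis_idem_tuple (e_basis := e_basis)) => d.
  apply: iff_trans (mem_coordsub e_basis _ _) _.
  split=> [d0 [s i] | d0 s i sT]; first by rewrite !inE andbT => /d0.
  by apply: d0; rewrite !inE andbT.
rewrite (det_phi_mx_eigen (lam := fun k => Nm (A (enum_val k).1)) _ basJ).
- rewrite -(big_enum_val (fun si => Nm (A si.1))) -prodrXl.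
  rewrite (eq_bigl (fun si : 'I_n * 'I_f => (si.1 \in T) && true)) => [|[s i]].
    rewrite -(pair_big _ xpredT (fun s _ => Nm (A s))).
    by apply: eq_bigr => s _; rewrite prodr_const card_ord.
  by rewrite !inE.
- by have [] := coordsub_subobject T.
- by move=> k; rewrite nth_mktuple iter_phi_Nm.
Qed.

End DiagonalPhi.

(** * The rank 3 normal form *)

Section Rank3.
Variables (f : nat) (E : fieldType) (D : filtered_phi_module f E).
Variable e : 'I_3 -> D.
Hypothesis e_basis : is_basis (scal D) e.
Implicit Types (T : {set 'I_3}).

Notation eps s i := (idem_vec e (s%R, i)).

(* The plane is the kernel of [c2 - y c0 - y' c1], where c0, c1, c2 are the
   coordinates at tau_i. *)
Lemma dim_cap_plane T i (y y' : E) :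
  (\dim (component i (coordsub e T) :&:
         (<[eps 0 i + y *: eps 2 i]> + <[eps 1 i + y' *: eps 2 i]>)) +
   ~~ [&& (0%R \in T) ==> (y == 0%R), (1%R \in T) ==> (y' == 0%R)
        & 2%R \notin T])%N = #|T|.
Proof.
pose cf s := coordf e_basis (s, i).
pose h : 'Hom(D, E^o) := (cf 2 - y *: cf 0 - y' *: cf 1).
have hE d : h d = cf 2 d - y * cf 0 d - y' * cf 1 d.
  by rewrite /h !(add_lfunE, opp_lfunE, scale_lfunE).
have h_eps s : h (eps s i) = (s == 2)%:R - y * (s == 0)%:R - y' * (s == 1)%:R.
  by rewrite hE !coordf_idem_vec !xpair_eqE eqxx !andbT ![_ == s]eq_sym.
set P := (<[_]> + <[_]>)%VS.
(* The equality holds only inside the component at tau_i: the kernel of [h] in D also contains all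
   the other components. *)
have PE : (component i (coordsub e T) :&: P = component i (coordsub e T) :&: lker h)%VS.
  apply/vspaceP => d; rewrite !memv_cap.
  case: (boolP (d \in component i _)) => //= /(mem_coordsub_component e_basis) d0.
  rewrite memv_ker; apply/idP/eqP.
    case/memv_addP => _ /vlineP[k ->] [_ /vlineP[k' ->] ->].
    rewrite linearD !linearZ /= !linearD /= !linearZ /= !h_eps /= /GRing.scale /=.
    ring.
  rewrite hE => /eqP; rewrite subr_eq0 => /eqP /(canRL (subrK _)) d2.
  have -> : d = (cf 0 d : E) *: (eps 0 i + y *: eps 2 i) +
                (cf 1 d : E) *: (eps 1 i + y' *: eps 2 i).
    apply: (coordf_inj (e_basis := e_basis)) => -[s j].
    rewrite linearD !linearZ /= !linearD /= !linearZ /= !coordf_idem_vec !xpair_eqE.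
    have [->|ji] := eqVneq j i; last first.
      by rewrite !andbF d0 ?(negPf ji) ?andbF // !(scaler0, addr0).
    rewrite !andbT -/(cf s) /GRing.scale /=.
    by move: s {d0}; apply: ord3P; rewrite /= ?d2; ring.
  by apply: memv_add; apply: memvZ; apply: memv_line.
rewrite {}PE -(dim_coordsub_component e_basis T i) -[RHS](dim_cap_lker h).
(* [h] takes the values -y, -y' and 1 on the three basis vectors at tau_i, so the condition says
   that it vanishes on those indexed by [T]. *)
congr (_ + ~~ _)%N; apply: esym; apply/idP/idP => [/subvP sub_ker | /and3P[y0 y'0 T2]].
  have sker s : s \in T -> h (eps s i) = 0.
    move=> sT; apply/eqP; rewrite -memv_ker; apply: sub_ker.
    apply/(mem_coordsub_component e_basis) => t j; rewrite coordf_idem_vec xpair_eqE.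
    by move=> tj; case: (t =P s) tj => [->|//]; rewrite sT /= => /negPf ->.
  apply/and3P; split.
  - by apply/implyP => /sker; rewrite h_eps /= => /eqP;
       rewrite mulr0 mulr1 subr0 sub0r oppr_eq0.
  - by apply/implyP => /sker; rewrite h_eps /= => /eqP;
       rewrite mulr0 mulr1 subr0 sub0r oppr_eq0.
  by apply/negP => /sker; rewrite h_eps /= => /eqP; rewrite !mulr0 !subr0 oner_eq0.
apply/subvP => d /(mem_coordsub_component e_basis) d0; rewrite memv_ker hE /cf.
rewrite (d0 2 i) ?(negPf T2) // sub0r.
have -> : y * coordf e_basis (0, i) d = 0.
  have [T0|T0] := boolP (0 \in T); last by rewrite d0 ?(negPf T0) // mulr0.
  by move: y0; rewrite T0 => /eqP ->; rewrite mul0r.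
have -> : y' * coordf e_basis (1, i) d = 0.
  have [T1|T1] := boolP (1 \in T); last by rewrite d0 ?(negPf T1) // mulr0.
  by move: y'0; rewrite T1 => /eqP ->; rewrite mul0r.
by rewrite oppr0 addr0.
Qed.

(** The spanning vector has coordinates (1, y, z); it lies in the coordinate subspace exactly when
    its support is contained in [T]. *)
Lemma dim_cap_line T i (y z : E) :
  \dim (component i (coordsub e T) :&:
        <[eps 0 i + y *: eps 1 i + z *: eps 2 i]>) =
  [&& 0 \in T, (y == 0%R) || (1 \in T) & (z == 0) || (2 \in T)].
Proof.
set w := _ + _.
have wE s j : coordf e_basis (s, j) w = (j == i)%:R * [:: 1; y; z]`_s.
  rewrite /w !linearD /= !linearZ /= !coordf_idem_vec !xpair_eqE.
  move: s; apply: ord3P; rewrite /= /GRing.scale /=; case: (j == i);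
    by rewrite ?(mul0r, mul1r, mulr0, mulr1, addr0, add0r).
rewrite dim_cap_vline; last first.
  apply/eqP => /(congr1 (coordf e_basis (0, i))).
  by rewrite wE linear0 eqxx mul1r => /eqP; rewrite oner_eq0.
congr nat_of_bool; apply/idP/idP => [/(mem_coordsub_component e_basis) w0 | wT].
  have w0' s : s \notin T -> [:: 1; y; z]`_s == 0.
    move=> sT; have := w0 s i; rewrite wE eqxx mul1r andbT => -> //.
  apply/and3P; split; last 2 first.
  - by rewrite orbC -implyNb; apply/implyP => /w0'.
  - by rewrite orbC -implyNb; apply/implyP => /w0'.
  by apply: contraT => /w0'; rewrite oner_eq0.
apply/(mem_coordsub_component e_basis) => s j; rewrite wE negb_and => /orP[].
  case/and3P: wT => T0 T1 T2; move: s; apply: ord3P; rewrite ?T0 //= => sT.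
  - by move: T1; rewrite (negPf sT) orbF => /eqP ->; rewrite mulr0.
  - by move: T2; rewrite (negPf sT) orbF => /eqP ->; rewrite mulr0.
by move=> /negPf ->; rewrite mul0r.
Qed.

End Rank3.

(** * Hodge and Newton numbers of the coordinate submodules *)

Section NormalForm.
Variables (f : nat) (E : fieldType) (D : filtered_phi_module f E).
Variables (e : 'I_3 -> D) (k1 k2 : 'I_f -> nat).
Variables x1 x2 x2' x2'' a b c : Etau f E.
Hypothesis D_normal : normal_form e k1 k2 x1 x2 x2' x2'' a b c.
Implicit Types (T : {set 'I_3}) (U : {vspace D}).

Local Notation I1 := (I1 k1 k2).
Local Notation I2 := (I2 e k1 k2 x2 x2').
Local Notation I3 := (I3 e k1 k2 x1 x2'').

Let e_basis := nf_basis D_normal.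

Definition diag_coef (s : 'I_3) : Etau f E := [:: a; b; c]`_s.

Lemma phi_diag s : phi D (e s) = scal D (diag_coef s) (e s).
Proof.
rewrite (nf_phi D_normal) (bigD1 s) //= big1 ?addr0 => [|t ts].
  by rewrite !mxE eqxx mulr1n.
by rewrite !mxE (negPf ts) mulr0n scal0.
Qed.

Lemma diag_coef_neq0 s i : diag_coef s i != 0.
Proof. by have [a0 b0 c0] := nf_units D_normal i; move: s; apply: ord3P. Qed.

Lemma Nm_diag_coef_inj : injective (fun s => Nm (diag_coef s)).
Proof.
have [/eqP ab /eqP ac /eqP bc] := nf_norms D_normal.
by apply: ord3P; apply: ord3P => //= /esym.
Qed.

(** For f = 0 all norms would be the empty product, against their distinctness. *)
Lemma f_gt0 : (0 < f)%N.
Proof.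
have [/eqP ab _ _] := nf_norms D_normal; case: posnP => // f0; case: ab.
by rewrite /Nm !big1 // => i; have := ltn_ord i; lia.
Qed.

(** The truncated subtraction is exact: for empty [T] the bracketed condition holds and nothing is
    subtracted. *)
Definition plane_dim T i : nat :=
  #|T| - ~~ [&& (0%R \in T) ==> (x2 i == 0%R), (1%R \in T) ==> (x2' i == 0%R)
              & 2%R \notin T].

Definition line_dim T i : nat :=
  [&& 0%R \in T, (x1 i == 0%R) || (1%R \in T) & (x2'' i == 0%R) || (2%R \in T)].

(** For type F0 the plane fills the [k1 i] steps from 1 to [k1 i], and the line the next
    [k2 i - k1 i]; the other types have one jump, at [k2 i]. *)
Definition hodge T i : nat :=
  (i \in I1) * (plane_dim T i * k1 i + line_dim T i * (k2 i - k1 i)) +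
  (i \in I2) * (plane_dim T i * k2 i) + (i \in I3) * (line_dim T i * k2 i).

Lemma dim_cap_planeE T i :
  \dim (component i (coordsub e T) :&: (line i (e 0 + x2 i *: e 2)%R +
                                        line i (e 1 + x2' i *: e 2)%R)) = plane_dim T i.
Proof.
by rewrite /line !linearD !linearZ /= /plane_dim
  -(dim_cap_plane e_basis T i (x2 i) (x2' i)) addnK.
Qed.

Lemma dim_cap_lineE T i :
  \dim (component i (coordsub e T) :&: line i (e 0 + x1 i *: e 1 + x2'' i *: e 2)) =
  line_dim T i.
Proof. by rewrite /line !linearD !linearZ /= (dim_cap_line e_basis). Qed.

(** Otherwise the component of Fil^1 at tau_i would be both a plane and a line. Hence [I2] and [I3]
    are disjoint. *)
Lemma type_F12_excl i : (0 < k2 i)%N ->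
  type_F1 e k2 x2 x2' i -> type_F2 e k2 x1 x2'' i -> False.
Proof.
move=> k_gt0 [_ _ /(_ 1)] + [_ _ /(_ 1)]; rewrite /= lez_nat k_gt0 => -> PL.
have := dim_cap_lineE finset.setT i; rewrite -PL dim_cap_planeE.
by rewrite /plane_dim /line_dim cardsT card_ord !inE !orbT !andbF.
Qed.

(** The Boolean indices let one case analysis replace the three memberships in [hodge] by constants
    and expose the filtration. *)
Variant index_spec i : bool -> bool -> bool -> Prop :=
  | IndexF0 of (0 < k1 i < k2 i)%N & type_F0 e k1 k2 x1 x2 x2' x2'' i :
      index_spec i true false false
  | IndexF1 of (0 < k2 i)%N & type_F1 e k2 x2 x2' i :
      index_spec i false true false
  | IndexF2 of (0 < k2 i)%N & type_F2 e k2 x1 x2'' i :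
      index_spec i false false true
  | IndexF3 of k2 i = 0%N & type_F3 D i : index_spec i false false false.

Lemma indexP i : index_spec i (i \in I1) (i \in I2) (i \in I3).
Proof.
rewrite !inE; have k12 := nf_weights D_normal i.
have [two|ntwo] := boolP (two_weights k1 k2 i).
  have k_gt0 : (0 < k2 i)%N by move: two; rewrite /two_weights; lia.
  have -> : (0 < k1 i < k2 i)%N = false by move: two; rewrite /two_weights; lia.
  case: (nf_F12 D_normal two) => F; rewrite !andTb (asboolT F) asboolF.
  - by constructor.
  - exact: type_F12_excl.
  - by constructor.
  - by move=> F1; apply: type_F12_excl F1 F.
rewrite !andFb.
have [k1_pos|k1_neg] := boolP (0 < k1 i < k2 i)%N.
  by constructor=> //; apply: (nf_F0 D_normal).
have k20 : k2 i = 0%N by move: ntwo; rewrite /two_weights; lia.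
by constructor=> //; apply: (nf_F3 D_normal) => //; lia.
Qed.

Lemma Fil0_full : (fullv <= Fil D 0)%VS.
Proof.
apply/subvP => d _; rewrite [d]idem_sum; apply: memv_suml => i _.
have: component i (Fil D 0) = component i fullv.
  by case: (indexP i) => [_ [_ _ _ ->]|_ [_ _ ->]|_ [_ _ ->]|_ ->].
move=> FilE; apply: (subvP (component_sub i (Fil_submodule D 0))).
by rewrite FilE memv_img ?memvf.
Qed.

Lemma Fil_top (N : nat) : (forall i, k2 i < N)%N -> (Fil D N <= 0)%VS.
Proof.
move=> kN; apply/subvP => d dF; rewrite [d]idem_sum; apply: memv_suml => i _.
have <- : component i (Fil D N) = 0%VS; last exact: memv_img.
have ki := kN i; have k12 := nf_weights D_normal i.
have N0 : (N%:Z <= 0) = false by rewrite lez_nat; lia.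
have Nk1 : (N%:Z <= k1 i) = false by rewrite lez_nat; lia.
have Nk2 : (N%:Z <= k2 i) = false by rewrite lez_nat; lia.
by case: (indexP i) => [_ [_ _ _ ->]|_ [_ _ ->]|_ [_ _ ->]|_ ->];
  rewrite N0 ?Nk1 ?Nk2.
Qed.

(** The filtration is read at j + 1, so its ranges 1..k1 and k1+1..k2 become [j < k1 i] and
    [k1 i <= j < k2 i]. *)
Lemma dim_cap_Fil T i (j : nat) :
  \dim (component i (coordsub e T) :&: component i (Fil D (j%:Z + 1))) =
  ((i \in I1) * ((j < k1 i) * plane_dim T i + (k1 i <= j < k2 i) * line_dim T i) +
   (i \in I2) * ((j < k2 i) * plane_dim T i) +
   (i \in I3) * ((j < k2 i) * line_dim T i))%N.
Proof.
have jS : j%:Z + 1 = j.+1 :> int by rewrite intS addrC.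
rewrite jS; case: (indexP i) => [_ [_ _ _ ->]|_ [_ _ ->]|_ [_ _ ->]|_ ->];
  rewrite ?lez_nat /= ?mul1n ?mul0n ?addn0 ?add0n ?capv0 ?dimv0 //.
- have [jk|jk] := ltnP j (k1 i); first by rewrite dim_cap_planeE mul1n addn0.
  by case: ltnP => _; rewrite ?dim_cap_lineE ?capv0 ?dimv0 // mul1n.
- by case: ltnP => _; rewrite ?dim_cap_planeE ?capv0 ?dimv0 // mul1n.
- by case: ltnP => _; rewrite ?dim_cap_lineE ?capv0 ?dimv0 // mul1n.
Qed.

Lemma tH_coordsub T : tH (coordsub e T) = (\sum_i hodge T i)%N%:Z.
Proof.
pose N := (\max_i k2 i).+1; have kN i : (k2 i < N)%N by rewrite ltnS leq_bigmax.
rewrite (tH_sum_dim _ Fil0_full (Fil_top kN)); congr Posz.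
under [LHS]eq_bigr => j _ do rewrite (dim_capFil _ (coordsub_submodule e_basis T)).
rewrite exchange_big /=; apply: eq_bigr => i _.
under [LHS]eq_bigr => j _ do rewrite dim_cap_Fil.
rewrite !big_split /= -!big_distrr /=.
have k12 := nf_weights D_normal i; have ki := kN i.
rewrite /hodge; congr (_ * _ + _ * _ + _ * _)%N; try by rewrite sum_lt_const // ltnW.
rewrite big_split sum_lt_const ?(leq_trans k12) 1?ltnW //=; congr (_ + _)%N.
(* Adding the range [j < k1 i] to [k1 i <= j < k2 i] completes it to [j < k2 i], whose sum is
   known. *)
apply: (@addnI (\sum_(j < N) (j < k1 i) * line_dim T i)%N).
rewrite -big_split /= (eq_bigr (fun j : 'I_N => (j < k2 i) * line_dim T i)%N).
  by rewrite !sum_lt_const ?(leq_trans k12) 1?ltnW //= -mulnDr subnKC.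
by move=> j _; rewrite -mulnDl; congr (_ * _)%N; lia.
Qed.

(** * Weak admissibility and irreducibility as numerical conditions *)

Section Admissible.
Variable v : E -> rat.
Hypothesis vM : forall x y, x != 0 -> y != 0 -> v (x * y) = v x + v y.

Lemma Nm_diag_coef_neq0 s : Nm (diag_coef s) != 0.
Proof. by apply/prodf_neq0 => i _; apply: diag_coef_neq0. Qed.

Lemma tN_coordsub T : tN v (coordsub e T) = \sum_(s in T) v (Nm (diag_coef s)).
Proof.
rewrite -(val_prod vM) => [|s]; last exact: Nm_diag_coef_neq0.
have prod0 : \prod_(s in T) Nm (diag_coef s) != 0.
  by apply/prodf_neq0 => s _; apply: Nm_diag_coef_neq0.
have detX := det_phi_mx_coordsub e_basis phi_diag T.
have det0 : \det (phi_mx (coordsub e T)) != 0.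
  by have := expf_neq0 f prod0; rewrite -detX expf_eq0 f_gt0.
(* Here the f-th powers become a factor f, which is nonzero in the rationals and cancels. *)
have := congr1 v detX; rewrite !(valX vM) //; apply: mulfI.
by rewrite pnatr_eq0 -lt0n f_gt0.
Qed.

Definition newton T : rat := \sum_(s in T) v (Nm (diag_coef s)).

Definition hodge_sum T : rat := (\sum_i hodge T i)%N%:R.

Let subT T : subobject (coordsub e T) := coordsub_subobject e_basis phi_diag T.

Let subobjectE U : subobject U -> exists T, U = coordsub e T :=
  subobject_coordsub e_basis phi_diag diag_coef_neq0 Nm_diag_coef_inj f_gt0.

Lemma wa_coordsubE T : weakly_admissible_sub v (coordsub e T) <->
  newton T = hodge_sum T /\
  forall T', (coordsub e T' <= coordsub e T)%VS -> hodge_sum T' <= newton T'.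
Proof.
rewrite /weakly_admissible_sub tN_coordsub tH_coordsub; split.
  by case=> _ NH le; split=> // T' /(le _ (subT T')); rewrite tN_coordsub tH_coordsub.
case=> NH le; split=> // V /subobjectE[T' ->] /le.
by rewrite tN_coordsub tH_coordsub.
Qed.

Lemma weakly_admissibleE : weakly_admissible D v <->
  newton finset.setT = hodge_sum finset.setT /\ forall T, hodge_sum T <= newton T.
Proof.
rewrite /weakly_admissible -(coordsub_full e_basis).
apply: iff_trans (wa_coordsubE _) _; split=> -[NH le]; split=> // T.
by apply: le; rewrite (coordsub_full e_basis) subvf.
Qed.

(** Subobjects of a subobject are subobjects of D, so the inequalities are inherited and only the
    equality remains. *)
Lemma wa_coordsub_eq T : weakly_admissible D v ->
  weakly_admissible_sub v (coordsub e T) <-> newton T = hodge_sum T.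
Proof.
move=> /weakly_admissibleE[_ le]; apply: iff_trans (wa_coordsubE _) _.
by split=> [[]|NH] //; split.
Qed.

Lemma coordsub_inj : injective (coordsub e).
Proof.
have memT s T : idem_vec e (s, Ordinal f_gt0) \in coordsub e T <-> s \in T.
  apply: iff_trans (mem_coordsub e_basis _ _) _; split=> [s0 | sT t i tT].
    apply: contraT => /(s0 s (Ordinal f_gt0)) /eqP.
    by rewrite coordf_idem_vec eqxx oner_eq0.
  rewrite coordf_idem_vec xpair_eqE; case: eqP => // ts.
  by rewrite ts sT in tT.
move=> T T' TT'; apply/setP => s.
by apply/idP/idP => /memT sT; apply/memT;
  rewrite ?TT' // -TT'.
Qed.

Lemma coordsub0 : coordsub e finset.set0 = 0%VS.
Proof. exact: big_set0. Qed.

Lemma irreducibleE : weakly_admissible D v ->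
  irreducible D v <->
  forall T, T != finset.set0 -> T != finset.setT -> hodge_sum T < newton T.
Proof.
move=> wa; have /weakly_admissibleE[_ le] := wa.
split=> [[_ irr] T T0 T1 | lt].
  rewrite lt_neqAle le andbT; apply/eqP => /esym /(wa_coordsub_eq T wa) /irr.
  rewrite -coordsub0 -(coordsub_full e_basis) => -[] /coordsub_inj TE.
    by rewrite TE eqxx in T0.
  by rewrite TE eqxx in T1.
split=> [|U waU].
  rewrite -coordsub0 -(coordsub_full e_basis) => /coordsub_inj /setP /(_ 0).
  by rewrite !inE.
have [subU _ _] := waU; have [T UE] := subobjectE subU; move: waU.
rewrite {}UE => /(wa_coordsub_eq T wa) NH.
have [->|T0] := eqVneq T finset.set0; first by left; apply: coordsub0.
have [->|T1] := eqVneq T finset.setT; first by right; apply: coordsub_full.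
by have := lt T T0 T1; rewrite NH ltxx.
Qed.

End Admissible.

End NormalForm.

(** Compares the two sides at one index: by filtration type, by the 0/1 values allowed there, and by
    whether [x i] vanishes. The test on [1 + _] comes from x2'' = 1 + x1 when x2 = x2' = 1. *)
Ltac eval_hodge D_normal x i :=
  rewrite /hodge /plane_dim /line_dim card_set3 /=;
  case: (indexP D_normal i) =>
    [k12 [[->|->] [->|->] -> _] | _ [[->|->] [->|->] _] | _ [[->|->] [->|->] _] | _ _];
  rewrite !inE ?[0 == 1]eq_sym ?(eqxx, oner_eq0, mul0r, mulr0, mulr1, add0r, addr0) /=
    ?(mul0n, muln0) //;
  (case: (eqVneq (x i) 0); [let x0 := fresh in move=> x0; rewrite ?x0 | move=> _]);
  rewrite ?(eqxx, oner_eq0, addr0) //=; try case: (1 + _ == 0) => /=;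
  try lia.

Theorem proposition1p2 (p : nat) (p_prime : prime p) (p_odd : odd p)
    (S : padic_coefficients p)
    (D : filtered_phi_module (degf S) (E S))
    (e : 'I_3 -> D) (k1 k2 : 'I_(degf S) -> nat)
    (x1 x2 x2' x2'' a b c : Etau (degf S) (E S))
    (D_normal : normal_form e k1 k2 x1 x2 x2' x2'' a b c) :
  let v := @vE p S in
  let k := k2 in
  let I1 := I1 k1 k2 in
  let I2 := I2 e k1 k2 x2 x2' in
  let I3 := I3 e k1 k2 x1 x2'' in
  let va := v (Nm a) in
  let vb := v (Nm b) in
  let vc := v (Nm c) in
  let bdA : rat := (\sum_(i in I1) (k1 i + k2 i) + \sum_(i in I2) 2 * k i
    + \sum_(i in I3) k i)%N%:R in
  let bdB : rat := (\sum_(i in I1 | (x2 i == 0%R) && (x1 i != 0%R)) k1 i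
    + \sum_(i in I1 | (x1 i == 0%R) && (x2 i == 0%R)) k2 i
    + \sum_(i in I2 | x2 i == 0%R) k i
    + \sum_(i in I3 | (x1 i == 0%R) && (x2'' i == 0%R)) k i)%N%:R in
  let bdC : rat := (\sum_(i in I1 | x2' i == 0%R) k1 i
    + \sum_(i in I2 | x2' i == 0%R) k i)%N%:R in
  let bdE : rat := (\sum_(i in I1 | x2'' i != 0%R) k1 i
    + \sum_(i in I1 | (x2'' i == 0%R) && (x2' i == 1%R)) k2 i
    + \sum_(i in I1 | (x2 i == 0%R) && (x2' i == 0%R)) (k1 i + k2 i)
    + \sum_(i in I2 | (x2' i == 1%R) || ((x2' i == 0%R) && (x2 i != 0%R))) k i
    + \sum_(i in I2 | (x2 i == 0%R) && (x2' i == 0%R)) 2 * k i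
    + \sum_(i in I3 | x2'' i == 0%R) k i)%N%:R in
  let bdF : rat := (\sum_(i in I1 | x1 i != 0%R) k1 i
    + \sum_(i in I1 | x1 i == 0%R) k2 i
    + \sum_(i in I2) k i
    + \sum_(i in I3 | x1 i == 0%R) k i)%N%:R in
  let bdG : rat := (\sum_(i in I1) k1 i + \sum_(i in I2) k i)%N%:R in
  let D0 := Etau_span (e 0) in
  let D1 := Etau_span (e 1) in
  let D2 := Etau_span (e 2) in
  let D01 := (D0 + D1)%VS in
  let D02 := (D0 + D2)%VS in
  let D12 := (D1 + D2)%VS in
  (weakly_admissible D v <->
     va + vb + vc = bdA /\
     [/\ bdB <= va, bdC <= vb & 0 <= vc] /\
     [/\ bdE <= va + vb, bdF <= va + vc & bdG <= vb + vc]) /\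
  (weakly_admissible D v ->
     (irreducible D v <->
        [/\ bdB < va, bdC < vb & 0 < vc] /\
        [/\ bdE < va + vb, bdF < va + vc & bdG < vb + vc]) /\
     (weakly_admissible_sub v D0 <-> va = bdB) /\
     (weakly_admissible_sub v D1 <-> vb = bdC) /\
     (weakly_admissible_sub v D2 <-> vc = 0) /\
     (weakly_admissible_sub v D01 <-> va + vb = bdE) /\
     (weakly_admissible_sub v D02 <-> va + vc = bdF) /\
     (weakly_admissible_sub v D12 <-> vb + vc = bdG)).
Proof.
move=> v k; subst k => I1 I2 I3 va vb vc bdA bdB bdC bdE bdF bdG D0 D1 D2 D01 D02 D12.
have vM : forall x y, x != 0 -> y != 0 -> v (x * y) = v x + v y.
  by case: (vE_val S).
pose N := newton a b c v; pose H := hodge_sum e k1 k2 x1 x2 x2' x2''.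
have [N0 N1 N2] : [/\ N [set 0]%SET = va, N [set 1]%SET = vb & N [set 2]%SET = vc].
  by rewrite /N /newton !big_set1.
have [N01 N02 N12] : [/\ N [set 0; 1]%SET = va + vb, N [set 0; 2]%SET = va + vc &
    N [set 1; 2]%SET = vb + vc].
  by rewrite /N /newton !big_setU1 ?inE //= !big_set1.
have N012 : N finset.setT = va + vb + vc.
  by rewrite /N /newton (eq_bigl xpredT) => [|s]; rewrite ?inE // !big_ord_recl big_ord0
    addr0 addrA; congr (v (Nm _) + v (Nm _) + v (Nm _)).
have Nempty : N finset.set0 = 0 by apply: big_set0.
have HE : [/\ H finset.set0 = 0, H [set 2]%SET = 0 & H finset.setT = bdA].
  split; rewrite /H /hodge_sum.
  - by rewrite big1 // => i _; eval_hodge D_normal x1 i.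
  - by rewrite big1 // => i _; eval_hodge D_normal x1 i.
  congr (_%:R); rewrite !sum_in -!big_split; apply: eq_bigr => i _.
  eval_hodge D_normal x1 i.
have HE1 : [/\ H [set 0]%SET = bdB, H [set 1]%SET = bdC, H [set 0; 1]%SET = bdE,
    H [set 0; 2]%SET = bdF & H [set 1; 2]%SET = bdG].
  by split; rewrite /H /hodge_sum; congr (_%:R);
    rewrite ?sum_in_cond ?sum_in -!big_split; apply: eq_bigr => j _;
    eval_hodge D_normal x1 j.
have [H0 H2 H012] := HE; have [HB HC HE01 HF HG] := HE1.
(* The relation is a parameter so that the same matching of subsets with (B)-(G) serves [<=] for
   admissibility and [<] for irreducibility. *)
have forall_subsets (R : rat -> rat -> Prop) :
    (forall T, T != finset.set0 -> T != finset.setT -> R (H T) (N T)) <->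
    [/\ R bdB va, R bdC vb & R 0 vc] /\
    [/\ R bdE (va + vb), R bdF (va + vc) & R bdG (vb + vc)].
  have card_neq (T : {set 'I_3}) : (0 < #|T| < 3)%N ->
      T != finset.set0 /\ T != finset.setT.
    by move=> T03; split; apply: contraTneq T03 => ->;
      rewrite ?cards0 ?cardsT ?card_ord.
  split=> [RT | [[RB RC RD] [RE RF RG]]].
    rewrite -N01 -N02 -N12 -N0 -N1 -N2 -HB -HC -H2 -HE01 -HF -HG.
    have R_mid (T : {set 'I_3}) (T03 : (0 < #|T| < 3)%N) : R (H T) (N T).
      by have [T0 T1] := card_neq T T03; apply: RT.
    by split; split; apply: R_mid; rewrite ?cards1 ?cards2.
  by apply: set3_ind;
    rewrite ?eqxx ?(N0, N1, N2, N01, N02, N12, HB, HC, H2, HE01, HF, HG).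
have [d0 d1 d2] : [/\ coordsub e [set 0]%SET = D0, coordsub e [set 1]%SET = D1 &
    coordsub e [set 2]%SET = D2] by rewrite /coordsub !big_set1.
have [d01 d02 d12] : [/\ coordsub e [set 0; 1]%SET = D01,
    coordsub e [set 0; 2]%SET = D02 & coordsub e [set 1; 2]%SET = D12].
  by rewrite /coordsub !big_setU1 ?inE //= !big_set1.
split=> [|wa].
  apply: iff_trans (weakly_admissibleE D_normal vM) _.
  rewrite -/H -/N N012 H012 -(forall_subsets (fun h n => h <= n)).
  split=> -[NH le]; split=> //.
  (* The two remaining subsets impose nothing new: the empty one gives 0 <= 0, the full one is the
     equality (A). *)
  move=> T; have [->|T0] := eqVneq T finset.set0; first by rewrite -/H -/N H0 Nempty.
  have [->|T1] := eqVneq T finset.setT; first by rewrite -/H -/N N012 H012 NH.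
  exact: le.
have waE (T : {set 'I_3}) U r h : coordsub e T = U -> N T = r -> H T = h ->
    weakly_admissible_sub v U <-> r = h.
  by move=> <- <- <-; apply: wa_coordsub_eq.
split; first by rewrite -(forall_subsets (fun h n => h < n)); apply: irreducibleE.
split; first exact: waE d0 N0 HB.
split; first exact: waE d1 N1 HC.
split; first exact: waE d2 N2 H2.
split; first exact: waE d01 N01 HE01.
by split; [exact: waE d02 N02 HF | exact: waE d12 N12 HG].
Qed.
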